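(* Let $n\ge 1$ and let $q=(q_1,\ldots,q_n)$ be a weakly increasing sequence of positive integers such that $q_j$ divides $1+\sum_{i\neq j}q_i$ for every $j=1,\ldots,n$. Let $\Delta_{(1,q)}:=\operatorname{conv}\{e_1,\ldots,e_n,-\sum_{i=1}^n q_ie_i\}\subset\mathbb{R}^n$. Then \[ h^\ast(\Delta_{(1,q)};z)=\sum_{b=0}^{q_1+\cdots+q_n} z^{w(b)},\qquad\text{where}\qquad w(b):=b-\sum_{i=1}^n\left\lfloor \frac{q_i b}{1+q_1+\cdots+q_n}\right\rfloor . \]
   Context: $e_i$ denotes the $i$-th standard basis vector of $\mathbb{R}^n$. For a $d$-dimensional lattice polytope $P\subset\mathbb{R}^n$, the Ehrhart series is $\sum_{t\ge 0}|tP\cap\mathbb{Z}^n|z^t=\frac{h_0^\ast+h_1^\ast z+\cdots+h_d^\ast z^d}{(1-z)^{d+1}}$, and the numerator polynomial $h^\ast(P;z)=\sum_i h_i^\ast z^i$ is the $h^\ast$-polynomial of $P$. *)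

(* Defs.v *)
From HB Require Import structures.
From mathcomp Require Import all_boot all_order all_algebra.
From mathcomp Require Import mathcomp_extra boolp classical_sets functions.
From mathcomp Require Import cardinality reals.

Set Implicit Arguments.
Unset Strict Implicit.
Unset Printing Implicit Defensive.

Import Order.TTheory GRing.Theory Num.Theory.
Local Open Scope classical_set_scope.
Local Open Scope card_scope.
Local Open Scope ring_scope.

Section Ehrhart.
Variables (R : realType) (n : nat).
Implicit Types (A P : set 'rV[R]_n).

Definition conv A : set 'rV[R]_n :=
  [set x | exists k (v : 'I_k -> 'rV[R]_n) (a : 'I_k -> R),
    [/\ forall i, A (v i), forall i, 0 <= a i, \sum_i a i = 1 &
        x = \sum_i a i *: v i]].

Definition dilate (t : nat) P : set 'rV[R]_n := [set t%:R *: x | x in P].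

Definition lattice : set 'rV[R]_n :=
  range (fun z : 'rV[int]_n => map_mx intr z).

(* U is the direction space of the affine hull of A *)
Definition direction_space A (U : {vspace 'rV[R]_n}) :=
  (forall x y, A x -> A y -> x - y \in U) /\
  (forall W : {vspace 'rV[R]_n},
     (forall x y, A x -> A y -> x - y \in W) -> (U <= W)%VS).

Definition has_dim A (d : nat) :=
  A !=set0 /\ exists2 U, direction_space A U & \dim U = d.

(* In particular, all the sets tP ∩ Z^n are finite. *)
Definition ehrhart_count P (L : nat -> nat) :=
  forall t, dilate t P `&` lattice #= `I_(L t).

(* product of formal power series, given by their coefficient sequences *)
Definition fps_mul (a b : nat -> int) : nat -> int :=
  fun k => \sum_(j < k.+1) a j * b (k - j)%N.

(* h is the h^*-polynomial of P: deg h <= d = dim P and, as formal power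
   series, (1 - z)^(d+1) * \sum_t |tP ∩ Z^n| z^t = h(z); see is_hstar_uniq. *)
Definition is_hstar P (h : {poly int}) :=
  exists d L, [/\ has_dim P d, ehrhart_count P L, (size h <= d.+1)%N &
    fps_mul (fun j => ((1 - 'X) ^+ d.+1 : {poly int})`_j)
            (fun t => (L t)%:Z)
    = (fun k => h`_k)].

Lemma is_hstar_uniq P h1 h2 : is_hstar P h1 -> is_hstar P h2 -> h1 = h2.
Proof.
move=> [d1 [L1 [[_ [U1 [hU1 mU1] <-]] hL1 _ e1]]].
move=> [d2 [L2 [[_ [U2 [hU2 mU2] <-]] hL2 _ e2]]].
have eU : U1 = U2 by apply/eqP; rewrite eqEsubv mU1 // mU2.
have eL : L1 = L2.
  apply/funext => t; apply/card_eq_II.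
  exact: card_eq_trans (card_esym (hL1 t)) (hL2 t).
apply/polyP => k; move: (congr1 (fun f => f k) e1) (congr1 (fun f => f k) e2).
by rewrite eU eL => <- <-.
Qed.

Definition Delta1q (q : 'I_n -> nat) : set 'rV[R]_n :=
  conv (range (fun i : 'I_n => delta_mx 0 i)
        `|` [set - \sum_i (q i)%:R *: delta_mx 0 i]).

End Ehrhart.

(* The subtraction is never truncated: see weight_subP. *)
Definition weight n (q : 'I_n -> nat) (b : nat) : nat :=
  (b - \sum_(i < n) (q i * b) %/ (1 + \sum_(j < n) q j))%N.

Lemma weight_subP n (q : 'I_n -> nat) b :
  (\sum_(i < n) (q i * b) %/ (1 + \sum_(j < n) q j) <= b)%N.
Proof.
set N := (1 + _)%N; have N0 : (0 < N)%N by [].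
rewrite -(leq_pmul2r N0) big_distrl /=.
apply: (@leq_trans (\sum_i q i * b)%N).
  by apply: leq_sum => i _; exact: leq_divM.
by rewrite -big_distrl /= mulnC leq_mul2l leq_addl orbT.
Qed.

(* Main.v *)
(** Let N = 1 + q_1 + ... + q_n.  A lattice point x lies in tΔ iff
    m := t - (x_1 + ... + x_n) >= 0 and N x_i + q_i m >= 0 for all i.  The
    second condition says that y_i := x_i + floor(q_i m / N) >= 0, so lattice
    points of tΔ correspond to (m, y) in N^(n+1) with w(m) + |y| = t.  Writing
    m = b + N c with b < N gives w(m) = w(b) + c, hence there are
    binom(t - w(b) + n, n) points for each b, and the Ehrhart series is
    (sum_(b < N) z^(w(b))) / (1 - z)^(n+1). *)
Require Import Defs.
From HB Require Import structures.
From mathcomp Require Import all_boot all_order all_algebra.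
From mathcomp Require Import boolp classical_sets functions.
From mathcomp Require Import cardinality reals.
From mathcomp Require Import zify ring.

Set Implicit Arguments.
Unset Strict Implicit.
Unset Printing Implicit Defensive.

Import Order.TTheory GRing.Theory Num.Theory.
Local Open Scope ring_scope.

(** * Arithmetic of the weight function *)

Lemma weight_addE n (q : 'I_n -> nat) b :
  (weight q b + \sum_(i < n) (q i * b) %/ (1 + \sum_(j < n) q j) = b)%N.
Proof. by rewrite /weight subnK ?weight_subP. Qed.

(** Follows from N b = b + sum q_i b by dividing each q_i b by N. Only residues remain on the right,
    and these are bounded and periodic in b. *)
Lemma weight_mul n (q : 'I_n -> nat) b :
  (weight q b * (1 + \sum_j q j) =
   b + \sum_(i < n) (q i * b) %% (1 + \sum_(j < n) q j))%N.
Proof.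
have := weight_addE q b; set N := (1 + _)%N => e.
have : (b * N = b + \sum_i q i * b)%N.
  by rewrite -big_distrl /= -[X in (X + _)%N]mul1n -mulnDl mulnC.
under eq_bigr do rewrite (divn_eq (q _ * b) N).
by rewrite -{1}e big_split /= -big_distrl /= mulnDl; lia.
Qed.

(** N w(b) is b plus n residues, all at most N - 1, hence less than N (n + 1). This bounds the
    degree of the numerator. *)
Lemma weight_le n (q : 'I_n -> nat) b :
  (b <= \sum_i q i)%N -> (weight q b <= n)%N.
Proof.
move=> ble; rewrite -ltnS -(@ltn_pmul2r (1 + \sum_j q j)) // weight_mul.
set N := (1 + _)%N; have bN : (b <= N.-1)%N by [].
apply: (@leq_ltn_trans (N.-1 + \sum_(i < n) N.-1)).
  by apply: leq_add => //; apply: leq_sum => i _; rewrite -ltnS ltn_mod.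
by rewrite sum_nat_const card_ord -mulSn ltn_mul2l /=.
Qed.

Lemma weightDM n (q : 'I_n -> nat) b c :
  (weight q (b + (1 + \sum_j q j) * c) = weight q b + c)%N.
Proof.
apply/eqP; rewrite -(@eqn_pmul2r (1 + \sum_j q j)) // [eqbRHS]mulnDl !weight_mul.
set N := (1 + _)%N.
have -> : (\sum_i (q i * (b + N * c)) %% N = \sum_i (q i * b) %% N)%N.
  apply: eq_bigr => i _.
  by rewrite mulnDr mulnCA [(N * _)%N]mulnC addnC modnMDl.
by apply/eqP; rewrite addnAC [(c * N)%N]mulnC.
Qed.

(** * Formal power series and finite counting *)

Lemma fps_mul_coef (p : {poly int}) (g : nat -> int) k :
  fps_mul (fun j => p`_j) g k = (p * \poly_(t < k.+1) g t)`_k.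
Proof.
rewrite coefM; apply: eq_bigr => j _.
by rewrite coef_poly ltnS leq_subr.
Qed.

(** Moves one factor 1 - z from the polynomial to the series, where it acts as backward difference;
    the [match] supplies the value 0 at index -1. *)
Lemma fps_mul_1subX (p : {poly int}) (g : nat -> int) k :
  fps_mul (fun j => (p * (1 - 'X))`_j) g k =
  fps_mul (fun j => p`_j)
    (fun t => g t - (if t is s.+1 then g s else 0)) k.
Proof.
rewrite fps_mul_coef -mulrA coefM; apply: eq_bigr => j _; congr (_ * _).
have : (k - j < k.+1)%N by rewrite ltnS leq_subr.
move: (k - j)%N => m mk; rewrite mulrBl mul1r coefB coefXM !coef_poly mk.
by case: m mk => //= m /ltnW ->.
Qed.

(** This is the expansion of z^w / (1 - z)^(n+1), by induction on n: the backward difference of the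
    binomial sequence for n + 1 is the one for n. *)
Lemma fps_mul_bin n w k :
  fps_mul (fun j => ((1 - 'X) ^+ n.+1 : {poly int})`_j)
    (fun t => (if (w <= t)%N then 'C(t - w + n, n) else 0%N)%:Z) k
  = (k == w)%:R.
Proof.
elim: n => [|n IH]; rewrite exprSr fps_mul_1subX.
  rewrite fps_mul_coef expr0 mul1r coef_poly ltnSn.
  case: k => [|k]; first by case: w => [|w] //=; rewrite bin0.
  rewrite !bin0; case: (ltngtP w k.+1) => [wk|wk|->] /=.
  - by rewrite -ltnS wk /=; lia.
  - by rewrite leqNgt ltnW //=; lia.
  - by rewrite ltnn.
rewrite -{}IH; congr fps_mul; apply/funext => -[|t].
  by case: w => [|w] //=; rewrite !add0n !binn.
case: (ltngtP w t.+1) => [wt|wt|->] /=.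
(* Beyond index w the difference is Pascal's rule. *)
- rewrite -ltnS wt subSn // !addSn addnS binS; lia.
- by rewrite leqNgt ltnW.
- by rewrite ltnn subnn !add0n !binn.
Qed.

Lemma fps_mul_sum (I : Type) (r : seq I) (a : nat -> int)
    (g : I -> nat -> nat) k :
  fps_mul a (fun t => (\sum_(i <- r) g i t)%N%:Z) k =
  \sum_(i <- r) fps_mul a (fun t => (g i t)%:Z) k.
Proof.
rewrite /fps_mul exchange_big; apply: eq_bigr => j _ /=.
by rewrite -mulr_sumr (big_morph Posz PoszD (erefl _)).
Qed.

(** As s <= t, the entry bound t is never active, so the count equals the one with entries bounded
    by s. The looser bound lets all residues b share one tuple type. *)
Lemma card_tuple_sum_le n s t : (s <= t)%N ->
  #|[set y : n.-tuple 'I_t.+1 | (\sum_i tnth y i <= s)%N]%SET|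
  = 'C(s + n, n).
Proof.
move=> st; rewrite addnC -card_partial_ord_partitions.
have st1 : (s.+1 <= t.+1)%N by [].
pose f (y : n.-tuple 'I_s.+1) : n.-tuple 'I_t.+1 := map_tuple (widen_ord st1) y.
have f_inj : injective f.
  move=> y z /(congr1 val) /= e; apply: val_inj.
  by apply: inj_map e => i j /(congr1 val) /= ij; apply: val_inj.
rewrite -(card_imset _ f_inj); apply: eq_card => y; rewrite inE.
apply/idP/imsetP => [ys|[z zs ->]]; last first.
  by move: zs; rewrite inE big_tuple; under eq_bigr do rewrite tnth_map.
have yi i : (tnth y i < s.+1)%N.
  by rewrite ltnS (leq_trans _ ys) // (bigD1 i) //= leq_addr.
exists [tuple Ordinal (yi i) | i < n].
  by rewrite inE big_tuple; under eq_bigr do rewrite tnth_mktuple.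
apply: eq_from_tnth => i; apply: val_inj.
by rewrite tnth_map /= tnth_mktuple.
Qed.

Lemma card_image_finset (T : finType) (U : Type) (A : {set T}) (f : T -> U) :
  {in A &, injective f} -> ([set f x | x in [set` A]] #= `I_#|A|)%card%classic.
Proof.
move=> f_inj.
have -> : ([set f x | x in [set` A]] =
          range (fun i : 'I_#|A| => f (enum_val i)))%classic.
  apply/seteqP; split=> [_ [x xA <-]|_ [i _ <-]] /=.
    by exists (enum_rank_in xA x) => //; rewrite enum_rankK_in.
  by exists (enum_val i) => //; exact: enum_valP.
rewrite (card_eqr card_II); apply: inj_card_eq => i j _ _ ij.
by apply: enum_val_inj; apply: f_inj ij; exact: enum_valP.
Qed.

(** * Facets and dimension of the simplex *)

Definition simplex_vertices (R : realType) n (q : 'I_n -> nat) : set 'rV[R]_n :=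
  (range (fun i : 'I_n => delta_mx 0 i)
   `|` [set - \sum_i (q i)%:R *: delta_mx 0 i])%classic.

Lemma apex_entry (R : realType) n (q : 'I_n -> nat) j :
  (- \sum_i (q i)%:R *: delta_mx 0 i : 'rV[R]_n) 0 j = - (q j)%:R.
Proof.
rewrite mxE summxE (bigD1 j) //= big1 ?addr0 => [|i ij].
  by rewrite !mxE !eqxx mulr1.
by rewrite !mxE eqxx /= [j == i]eq_sym (negbTE ij) mulr0.
Qed.

Lemma sum_delta_row (R : realType) n (j : 'I_n) :
  \sum_i (delta_mx 0 j : 'rV[R]_n) 0 i = 1.
Proof.
rewrite (bigD1 j) //= big1 ?addr0 => [|i ij]; first by rewrite mxE !eqxx.
by rewrite mxE eqxx /= (negbTE ij).
Qed.

(** These n + 1 affine forms are N times the barycentric coordinates: each equals N at one vertex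
    and 0 at the others. *)
Lemma simplex_vertices_facets (R : realType) n (q : 'I_n -> nat) (v : 'rV[R]_n) :
  simplex_vertices q v ->
  0 <= 1 - \sum_i v 0 i /\
  forall i, 0 <= (1 + \sum_j q j)%N%:R * v 0 i + (q i)%:R * (1 - \sum_j v 0 j).
Proof.
case=> [[j _ <-]|->].
  rewrite sum_delta_row subrr; split=> // i.
  by rewrite mulr0 addr0 mulr_ge0 // mxE.
have -> : \sum_i (- \sum_i (q i)%:R *: delta_mx 0 i : 'rV[R]_n) 0 i
          = - \sum_i (q i)%:R.
  by rewrite -[RHS]sumrN; apply: eq_bigr => i _; rewrite apex_entry.
rewrite opprK natrD natr_sum; split=> [|i].
  by rewrite addr_ge0 // sumr_ge0.
by rewrite apex_entry mulrN mulrC addNr.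
Qed.

Lemma dilate_Delta1qP (R : realType) n (q : 'I_n -> nat) t (x : 'rV[R]_n) :
  dilate t (@Delta1q R n q) x <->
  0 <= t%:R - \sum_i x 0 i /\
  forall i, 0 <= (1 + \sum_j q j)%N%:R * x 0 i
                 + (q i)%:R * (t%:R - \sum_j x 0 j).
Proof.
split.
  case=> _ [k [v [a [vA a0 a1 ->]]]] <-.
  have xE i : (t%:R *: \sum_j a j *: v j) 0 i = t%:R * \sum_j a j * v j 0 i.
    by rewrite mxE summxE; congr (_ * _); apply: eq_bigr => j _; rewrite mxE.
  (* Since the a_j sum to 1, the constant t can be absorbed, and each form at x becomes t times the
     convex combination of its values at the v_j. *)
  have mE : t%:R - \sum_i (t%:R *: \sum_j a j *: v j) 0 i =
            t%:R * \sum_j a j * (1 - \sum_i v j 0 i).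
    under eq_bigr do rewrite xE.
    rewrite -mulr_sumr exchange_big /= -[X in X - _]mulr1 -[X in _ * X - _]a1.
    rewrite -mulrBr -sumrB.
    by congr (_ * _); apply: eq_bigr => j _; rewrite mulrBr mulr1 mulr_sumr.
  rewrite mE; split=> [|i].
    rewrite mulr_ge0 // sumr_ge0 // => j _; rewrite mulr_ge0 //.
    by have [] := simplex_vertices_facets (vA j).
  rewrite xE mulrCA [(q i)%:R * _]mulrCA -mulrDr mulr_ge0 //.
  rewrite !mulr_sumr -big_split sumr_ge0 // => j _ /=.
  rewrite mulrCA [(q i)%:R * _]mulrCA -mulrDr mulr_ge0 //.
  by have [_ ->] := simplex_vertices_facets (vA j).
set N := (1 + _)%N; set m := t%:R - _ => -[m0 xi0].
have N0 : N%:R != 0 :> R by rewrite pnatr_eq0.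
have NE : N%:R = 1 + \sum_j (q j)%:R :> R by rewrite natrD natr_sum.
(* [None] indexes the apex; [c] holds the barycentric coordinates scaled to have sum t. *)
pose v (k : option 'I_n) : 'rV[R]_n :=
  if k is Some i then delta_mx 0 i else - \sum_i (q i)%:R *: delta_mx 0 i.
pose c (k : option 'I_n) : R :=
  if k is Some i then x 0 i + (q i)%:R * m / N%:R else m / N%:R.
have c0 k : 0 <= c k.
  case: k => [i|] /=; last by rewrite divr_ge0.
  have -> : x 0 i + (q i)%:R * m / N%:R
            = (N%:R * x 0 i + (q i)%:R * m) / N%:R by field.
  by rewrite divr_ge0.
have big_option (V : zmodType) (F : option 'I_n -> V) :
    \sum_k F k = F None + \sum_i F (Some i).
  rewrite (bigD1 None) //=; congr (_ + _).
  rewrite (reindex_omap Some id) => [|[]] //=.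
  by apply: eq_bigl => i; rewrite eqxx.
have c1 : \sum_k c k = t%:R.
  rewrite big_option big_split /= -!mulr_suml.
  rewrite addrCA -mulrDl -[X in (X + _) / _]mul1r -mulrDl -NE mulrAC divff //.
  by rewrite mul1r /m addrC subrK.
have xE : x = \sum_k c k *: v k.
  apply/rowP => j; rewrite big_option mxE mxE apex_entry summxE /=.
  rewrite (bigD1 j) //= big1 ?addr0 => [|i ij].
    by rewrite !mxE !eqxx /=; field.
  by rewrite !mxE eqxx [j == i]eq_sym (negbTE ij) mulr0.
have vA k : simplex_vertices q (v k).
  by case: k => [i|] /=; [left; exists i|right].
(* One cannot divide by t = 0; there the nonnegative [c k] sum to 0, so x = 0 is the zero multiple
   of any point of the simplex, here the apex. *)
have [t0|t_gt0] := posnP t.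
  have ck k : c k = 0.
    apply/eqP; move: c1; rewrite t0 => /eqP; rewrite psumr_eq0 // => /allP.
    by move=> /(_ k); rewrite mem_index_enum => /(_ isT).
  exists (v None); last first.
    by rewrite xE t0 scale0r big1 // => k _; rewrite ck scale0r.
  exists 1%N, (fun=> v None), (fun=> 1); split=> //; first by move=> _; exact: vA.
    by rewrite big_ord1.
  by rewrite big_ord1 scale1r.
have t_neq0 : t%:R != 0 :> R by rewrite pnatr_eq0 -lt0n.
exists (t%:R^-1 *: x); last by rewrite scalerA divff // scale1r.
have reE (V : zmodType) (F : option 'I_n -> V) :
    \sum_k F k = \sum_(k < #|{: option 'I_n}|) F (enum_val k).
  exact: reindex (onW_bij _ (enum_val_bij _)).
exists #|{: option 'I_n}|, (v \o enum_val), (fun k => c (enum_val k) / t%:R).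
split=> [k|k||].
- exact: vA.
- by rewrite divr_ge0.
- by rewrite -mulr_suml -(reE _ c) c1 divff.
- rewrite xE scaler_sumr reE.
  by apply: eq_bigr => k _; rewrite scalerA mulrC.
Qed.

Lemma has_dim_Delta1q (R : realType) n (q : 'I_n -> nat) :
  has_dim (@Delta1q R n q) n.
Proof.
have conv1 v : simplex_vertices q v -> @Delta1q R n q v.
  move=> vA; exists 1%N, (fun=> v), (fun=> 1); split=> //.
    by rewrite big_ord1.
  by rewrite big_ord1 scale1r.
pose v0 : 'rV[R]_n := - \sum_i (q i)%:R *: delta_mx 0 i.
have v0A : @Delta1q R n q v0 by apply: conv1; right.
split; first by exists v0.
exists fullv; last by rewrite dimvf dim_matrix mul1r.
split=> [x y _ _|W hW]; first exact: memvf.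
have dW i : delta_mx 0 i - v0 \in W.
  by apply: hW => //; apply: conv1; left; exists i.
have N0 : (1 + \sum_j q j)%N%:R != 0 :> R by rewrite pnatr_eq0.
have v0W : v0 \in W.
  (* With v0 = - sum q_i e_i, this combination equals -N v0; so v0, and then every e_i, lies in
     W. *)
  have : \sum_i (q i)%:R *: (delta_mx 0 i - v0) \in W.
    by apply: rpred_sum => i _; apply: rpredZ.
  under eq_bigr do rewrite scalerBr.
  rewrite sumrB -scaler_suml -natr_sum -[X in X - _]opprK -/v0 -opprD rpredN.
  rewrite -{1}[v0]scale1r -scalerDl -(natrD _ 1) => /(rpredZ (1 + \sum_j q j)%N%:R^-1).
  by rewrite scalerA mulVf // scale1r.
apply/subvP => x _; rewrite (row_sum_delta x); apply: rpred_sum => i _.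
by apply: rpredZ; rewrite -[delta_mx 0 i](subrK v0) rpredD.
Qed.

(** * Parametrization of the lattice points of a dilate *)

Section LatticePoints.
Variables (n : nat) (q : 'I_n -> nat) (t : nat).
Let N := (1 + \sum_(j < n) q j)%N.
Implicit Types p : 'I_N * n.-tuple 'I_t.+1.

Let total p := (weight q p.1 + \sum_i tnth p.2 i)%N.

(* [level (b, y)] is m = t - |x| for the lattice point x encoded by (b, y):
   the slack [t - total p] plays the role of c in m = b + N c. *)
Let level p := (p.1 + N * (t - total p))%N.

(** Entries of y are at most t only to stay in a finite type; the condition on [total] already
    forces this. *)
Definition point_params : {set 'I_N * n.-tuple 'I_t.+1} :=
  [set p | total p <= t]%N%SET.

Definition point_of_params p : 'rV[int]_n :=
  \row_i ((tnth p.2 i)%:Z - ((q i * level p) %/ N)%:Z).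

Lemma card_point_params :
  #|point_params| =
  (\sum_(b < N) if weight q b <= t then 'C(t - weight q b + n, n) else 0)%N.
Proof.
rewrite -sum1dep_card /total.
rewrite -(pair_big_dep xpredT
  (fun (b : 'I_N) (y : n.-tuple 'I_t.+1) => weight q b + \sum_i tnth y i <= t)%N (fun _ _ => 1%N)) /=.
apply: eq_bigr => b _; rewrite sum1dep_card; case: leqP => [wt|tw].
  rewrite -(@card_tuple_sum_le n (t - weight q b) t) ?leq_subr //.
  by apply: eq_card => y; rewrite !inE leq_subRL.
by apply: eq_card0 => y; rewrite inE leqNgt ltn_addr.
Qed.

(** When [total p <= t], periodicity gives w(m) = w(b) + t - total = t - |y| for m = [level p],
    while w(m) plus the floors is m. *)
Lemma sum_point_of_params p : p \in point_params ->
  \sum_i point_of_params p 0 i = t%:Z - (level p)%:Z.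
Proof.
rewrite inE => pt; under eq_bigr do rewrite mxE.
rewrite sumrB -!(big_morph Posz PoszD (erefl _)).
have := weight_addE q (level p); rewrite -/N {1}/level weightDM.
move: pt; rewrite /total; move: (level p) => l.
move: (weight q _) (\sum_i tnth p.2 i)%N (\sum_i (q i * l) %/ N)%N => w s f; lia.
Qed.

(** The coordinate sum determines m, then b is m mod N, and y is read off from the coordinates. *)
Lemma point_of_params_inj : {in point_params &, injective point_of_params}.
Proof.
move=> p p' pA p'A e; have le : level p = level p'.
  have := sum_point_of_params pA; rewrite e sum_point_of_params //; lia.
have e1 : p.1 = p'.1.
  apply: val_inj => /=; have /(congr1 (modn^~ N)) := le.
  by rewrite /level ![(N * _)%N]mulnC ![(_ + _ * N)%N]addnC !modnMDl !modn_small.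
have e2 : p.2 = p'.2.
  apply: eq_from_tnth => i; apply: val_inj => /=.
  by have /rowP/(_ i) := e; rewrite !mxE le; lia.
by case: p p' e1 e2 {pA p'A e le} => [? ?] [? ?] /= -> ->.
Qed.

Lemma point_of_paramsP (z : 'rV[int]_n) :
  (exists2 p, p \in point_params & point_of_params p = z) <->
  0 <= t%:Z - \sum_i z 0 i /\
  forall i, 0 <= N%:Z * z 0 i + (q i)%:Z * (t%:Z - \sum_j z 0 j).
Proof.
split=> [[p pA <-]|].
  rewrite sum_point_of_params // subKr; split=> // i; rewrite mxE.
  by have := leq_divM (q i * level p) N; nia.
case; case e: (_ - _) => [m|//] _ zi0.
(* With q_i m = N d + r and r < N, the hypothesis reads N (z_i + d) + r >= 0, which forces z_i + d >
   -1. *)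
have yi0 i : 0 <= z 0 i + ((q i * m) %/ N)%:Z.
  have N0 : (0 < N)%N by [].
  have := zi0 i; have := divn_eq (q i * m) N; have := ltn_pmod (q i * m) N0.
  move: N0 (_ %/ _)%N (_ %% _)%N => N0 d r; move: (z 0 i) => zi; nia.
pose y i := absz (z 0 i + ((q i * m) %/ N)%:Z).
have yE i : (y i)%:Z = z 0 i + ((q i * m) %/ N)%:Z by rewrite gez0_abs.
have yt : (weight q m + \sum_i y i = t)%N.
  have := weight_addE q m; rewrite -/N.
  have : (\sum_i y i)%N%:Z = \sum_i z 0 i + (\sum_i (q i * m) %/ N)%N%:Z.
    rewrite !(big_morph Posz PoszD (erefl _)) -big_split /=.
    by apply: eq_bigr => i _; rewrite yE.
  move: e; move: (weight q m) (\sum_i y i)%N (\sum_i (q i * m) %/ N)%N.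
  by move: (\sum_i z 0 i) => sz w s f; lia.
have yit i : (y i < t.+1)%N by rewrite ltnS -yt (bigD1 i) //=; lia.
have mN : (m %% N < N)%N by rewrite ltn_pmod.
have wm : weight q m = (weight q (m %% N) + m %/ N)%N.
  by rewrite -weightDM -/N addnC mulnC -divn_eq.
(* The residue is m mod N; the quotient m / N reappears as the slack t - [total p]. *)
pose p : 'I_N * n.-tuple 'I_t.+1 :=
  (Ordinal mN, [tuple Ordinal (yit i) | i < n]).
have sE : (\sum_i tnth p.2 i = \sum_i y i)%N.
  by apply: eq_bigr => i _; rewrite tnth_mktuple.
have tE : (total p + m %/ N = t)%N by rewrite /total sE -[RHS]yt wm addnAC.
have lE : level p = m by rewrite /level -[X in (X - _)%N]tE addKn addnC mulnC -divn_eq.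
exists p; first by rewrite inE -[leqRHS]tE leq_addr.
by apply/rowP => i; rewrite mxE lE tnth_mktuple /= yE addrK.
Qed.

End LatticePoints.

(** * The Ehrhart function and its series *)

Lemma ehrhart_count_Delta1q (R : realType) n (q : 'I_n -> nat) :
  ehrhart_count (@Delta1q R n q)
    (fun t => \sum_(0 <= b < (\sum_(i < n) q i).+1)
       if weight q b <= t then 'C(t - weight q b + n, n) else 0)%N.
Proof.
move=> t; rewrite big_mkord -(card_point_params q t).
pose f p : 'rV[R]_n := map_mx intr (@point_of_params n q t p).
have intr_inj : injective (map_mx intr : 'rV[int]_n -> 'rV[R]_n).
  move=> y z /rowP yz; apply/rowP => i.
  by apply: (@intr_inj R); have := yz i; rewrite !mxE.
rewrite (_ : (_ `&` _)%classic = [set f p | p in [set` point_params q t]]%classic).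
  by apply: card_image_finset => p p' pA p'A /intr_inj; exact: point_of_params_inj.
have facets (z : 'rV[int]_n) : dilate t (@Delta1q R n q) (map_mx intr z) <->
    exists2 p, p \in point_params q t & point_of_params p = z.
  rewrite dilate_Delta1qP point_of_paramsP.
  have -> : \sum_i (map_mx intr z : 'rV[R]_n) 0 i = (\sum_i z 0 i)%:~R.
    by rewrite rmorph_sum; apply: eq_bigr => i _; rewrite mxE.
  (* At an integer point the facet forms take integer values, so their signs can be tested over the
     integers. *)
  rewrite -[t%:R]/((t%:Z)%:~R) -rmorphB ler0z.
  by split=> -[m0 zi0]; split=> // i; have := zi0 i;
    rewrite mxE -[_%:R]/((Posz _)%:~R) -[(q i)%:R]/((Posz _)%:~R)
      -!rmorphM -rmorphD ler0z.
apply/seteqP; split=> [x [xD [z _ zx]]|x [p pA <-]].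
  by move: xD; rewrite -zx => /facets[p pA pz]; exists p; rewrite // /f pz.
by split; [apply/facets; exists p|exists (point_of_params p)].
Qed.

Theorem theorem2p2 (R : realType) (n : nat) (q : 'I_n -> nat)
    (n_ge1 : (1 <= n)%N)
    (q_gt0 : forall i, (0 < q i)%N)
    (q_incr : forall i j : 'I_n, (i <= j)%N -> (q i <= q j)%N)
    (q_dvd : forall j, (q j %| 1 + \sum_(i < n | i != j) q i)%N) :
  is_hstar (@Delta1q R n q)
    (\sum_(0 <= b < (\sum_(i < n) q i).+1) 'X^(weight q b)).

Proof.
exists n, (fun t => \sum_(0 <= b < (\sum_(i < n) q i).+1)
  if weight q b <= t then 'C(t - weight q b + n, n) else 0)%N.
split; [exact: has_dim_Delta1q|exact: ehrhart_count_Delta1q| |].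
  rewrite big_mkord; apply: (leq_trans (size_sum _ _ _)).
  by apply/bigmax_leqP => b _; rewrite size_polyXn ltnS weight_le // -ltnS.
(* By linearity each b contributes its own series, whose numerator is z^(w(b)). *)
apply/funext => k; rewrite fps_mul_sum coef_sum.
by apply: eq_bigr => b _; rewrite fps_mul_bin coefXn.
Qed.
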